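(* Let $Q^*$ be the symmetric fixed point of the Lloyd map on $\mathbb{S}^1$ associated with the von Mises density $h=h(\cdot;\kappa)$ with mean direction $0$. Assume $\beta>0$. Then $Q^*$ is linearly stable if and only if $$\frac{h(\pi/n)}{M}\cdot\frac{\pi}{n}<\frac{2}{1-\cos\left(\frac{2\pi k_*}{n}\right)},$$ where $$k_*=\begin{cases}n/2,& n\text{ even},\\ \lfloor n/2\rfloor,& n\text{ odd and large}.\end{cases}$$
   Context: $\mathbb{S}^1=\mathbb{R}/2\pi\mathbb{Z}$. The von Mises density with mean $0$ is $h(\theta;\kappa)=\frac{1}{2\pi I_0(\kappa)}e^{\kappa\cos\theta}$, $\kappa\ge0$, with $I_0$ the modified Bessel function of the first kind of order zero. For a cyclically ordered configuration $Q=(q_j)$ (indices mod $n$), put $m_j=\frac{q_j+q_{j+1}}2$ (with the appropriate $2\pi$ identification); the Voronoi cell of $q_j$ is $(m_{j-1},m_j)$, assumed of length strictly less than $\pi$. The Lloyd map is $$[T(Q)]_j=q_j+\frac{\int_{m_{j-1}}^{m_j}(\theta-q_j)h(\theta)\,d\theta}{\int_{m_{j-1}}^{m_j}h(\theta)\,d\theta}.$$ $Q^*=(2\pi j/n)_{j=0}^{n-1}$ is the symmetric configuration, treated in the paper as a fixed point of $T$, and $J(Q^* )=DT(Q^* )$ is the matrix of partial derivatives $\partial[T(Q)]_j/\partial q_k$ at $Q^*$. The paper takes $J(Q^* )$ to be circulant with diagonal entries $\alpha$, entries $\beta$ at positions $k=j\pm1\ (\mathrm{mod}\ n)$, and zeros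 elsewhere, where $$\alpha=1-\frac{\pi}{nM}h\left(\frac{\pi}{n}\right),\quad \beta=\frac{\pi}{2nM}h\left(\frac{\pi}{n}\right),\quad M=\int_{-\pi/n}^{\pi/n}h(\theta)\,d\theta,$$ so that its eigenvalues are $\lambda_k=\alpha+2\beta\cos(2\pi k/n)$, $k=0,\dots,n-1$, with $\lambda_0=1$. The mode $k=0$ is the neutral mode of rigid rotations; ''linearly stable'' is understood modulo this neutral mode, i.e. $|\lambda_k|<1$ for all $k=1,\dots,n-1$. *)

(* Defs.v *)
From HB Require Import structures.
From mathcomp Require Import all_boot all_order all_algebra.
From mathcomp Require Import all_classical all_reals all_analysis.
From mathcomp Require Import complex.

Set Implicit Arguments.
Unset Strict Implicit.
Unset Printing Implicit Defensive.

Import Order.TTheory GRing.Theory Num.Theory.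
Import numFieldNormedType.Exports.

Local Open Scope classical_set_scope.
Local Open Scope ring_scope.

Section VonMises.
Context {R : realType}.
Implicit Types kappa theta : R.

(* I_0(x) = sum_k (x/2)^(2k) / (k!)^2 *)
Definition bessel_I0 (x : R) : R :=
  limn (series (fun k : nat => (x / 2) ^+ k.*2 / (k`!)%:R ^+ 2)).

Definition von_mises kappa theta : R :=
  (2 * pi * bessel_I0 kappa)^-1 * expR (kappa * cos theta).

End VonMises.

(* A cyclically ordered configuration on R/2piZ is given by real
   representatives q_0 < ... < q_(n-1) < q_0 + 2pi; [succ_site] and
   [pred_site] are the representatives of q_(j+1) and q_(j-1) adjacent to q_j,
   shifted by 2pi when the index wraps around. *)
Section Lloyd.
Context {R : realType} {n : nat}.
Implicit Types (h : R -> R) (Q : 'rV[R]_n) (j k : 'I_n).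

Definition succ_site Q j : R :=
  Q 0 (ordS j) + (if j.+1 == n then 2 * pi else 0).

Definition pred_site Q j : R :=
  Q 0 (ord_pred j) - (if j == 0%N :> nat then 2 * pi else 0).

Definition midpoint_right Q j : R := (Q 0 j + succ_site Q j) / 2.
Definition midpoint_left Q j : R := (pred_site Q j + Q 0 j) / 2.

Definition voronoi_cell Q j : set R :=
  `]midpoint_left Q j, midpoint_right Q j[.

Definition lloyd_map h Q : 'rV[R]_n :=
  \row_j (Q 0 j +
    (\int[lebesgue_measure]_(theta in voronoi_cell Q j)
        ((theta - Q 0 j) * h theta)) /
    (\int[lebesgue_measure]_(theta in voronoi_cell Q j) h theta)).

Definition partials (T : 'rV[R]_n -> 'rV[R]_n) Q : 'M[R]_n :=
  \matrix_(j, k) 'D_(delta_mx 0 k) (fun P : 'rV[R]_n => T P 0 j) Q.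

End Lloyd.

Section SymmetricConfiguration.
Context {R : realType}.
Implicit Types (n : nat) (kappa : R).

Definition Qstar n : 'rV[R]_n := \row_(j < n) (2 * pi * j%:R / n%:R).

Definition cell_mass n kappa : R :=
  \int[lebesgue_measure]_(theta in `[- (pi / n%:R), pi / n%:R])
    von_mises kappa theta.

Definition alpha n kappa : R :=
  1 - pi / (n%:R * cell_mass n kappa) * von_mises kappa (pi / n%:R).

Definition beta n kappa : R :=
  pi / (2 * n%:R * cell_mass n kappa) * von_mises kappa (pi / n%:R).

Definition tridiag_circulant n (a b : R) : 'M[R]_n :=
  \matrix_(j, k) (if k == j then a
                  else if (k == ordS j) || (k == ord_pred j) then b else 0).

(* The coefficients alpha and beta are the derivatives of the centroid of a cell
   on which the density is symmetric about its site. For kappa > 0 the mean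
   direction is fixed at 0, so Jstar need not be the matrix of partial
   derivatives of [lloyd_map (von_mises kappa)] at Qstar. *)
Definition Jstar n kappa : 'M[R]_n :=
  tridiag_circulant n (alpha n kappa) (beta n kappa).

End SymmetricConfiguration.

(* Linear stability modulo rigid rotations: the complex eigenvalues of J, with
   algebraic multiplicity, are lam 0, ..., lam (n-1), where lam 0 = 1 belongs
   to the rotation vector (1, ..., 1) and every other one has modulus < 1. *)
Definition linearly_stable (R : realType) (n : nat) (J : 'M[R]_n) : Prop :=
  J *m (const_mx 1 : 'cV[R]_n) = const_mx 1 /\
  exists lam : nat -> R[i]%C,
    [/\ char_poly (map_mx (real_complex R) J)
          = \prod_(k < n) ('X - (lam k)%:P),
        lam 0%N = 1 &
        forall k : nat, (0 < k < n)%N -> `|lam k| < 1].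

(* n./2 is n/2 for n even and floor(n/2) for n odd. *)
Definition kstar (n : nat) : nat := n./2.

Definition stability_criterion (R : realType) (n : nat) (kappa : R) : Prop :=
  von_mises kappa (pi / n%:R) / cell_mass n kappa * (pi / n%:R)
    < 2 / (1 - cos (2 * pi * (kstar n)%:R / n%:R)).

(* Main.v *)
Require Import Defs.
From HB Require Import structures.
From mathcomp Require Import all_boot all_order all_algebra.
From mathcomp Require Import all_classical all_reals all_analysis.
From mathcomp Require Import complex.
From mathcomp Require Import zify ring lra.

Import Order.TTheory GRing.Theory Num.Theory.
Import numFieldNormedType.Exports.

Local Open Scope ring_scope.

(** Write [x = 2 * beta n kappa]; this is the left-hand side of the criterion,
    and [alpha n kappa = 1 - x].  The matrix [Jstar] is circulant, so the discrete
    Fourier vectors [(w ^+ (k * j))_j], with [w = exp(2 i pi / n)], diagonalize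
    it, with the real eigenvalues
    [mu k = alpha + 2 * beta * cos (2 pi k / n) = 1 - x * (1 - cos (2 pi k / n))].
    The Vandermonde matrix of the distinct powers of [w] is invertible, so these
    are all the eigenvalues with multiplicity
    ([char_poly_tridiag_circulant]).

    For [0 < k < n] the cosine is below 1 ([cos_root_lt1]), and [beta > 0] gives
    [mu k < 1]; hence [|mu k| < 1] amounts to [mu k > -1], that is to
    [x * (1 - cos (2 pi k / n)) < 2].  This is most demanding when the cosine is
    smallest, which happens at [k = kstar n] ([cos_kstar_le]), and for this [k] it
    is the criterion.

    In the other direction the enumeration of the eigenvalues in
    [linearly_stable] is only known up to order.  But the eigenvalue
    [mu (kstar n)] differs from 1, so it cannot be the one listed at index 0 and
    its modulus is among those bounded by 1
    ([linearly_stable_tridiag_circulant]). *)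

Lemma char_poly_diagonalized {F : fieldType} {n : nat} (A V : 'M[F]_n)
    (d : 'rV[F]_n) :
  V \in unitmx -> A *m V = V *m diag_mx d ->
  char_poly A = \prod_(k < n) ('X - (d 0 k)%:P).
Proof.
move=> Vu AV.
have -> : \prod_(k < n) ('X - (d 0 k)%:P) = char_poly (diag_mx d).
  rewrite char_poly_trig ?diag_mx_is_trig //.
  by apply: eq_bigr => k _; rewrite mxE eqxx mulr1n.
set Vp := map_mx (@polyC F) V.
have Vp0 : \det Vp != 0.
  by rewrite det_map_mx /= polyC_eq0 -unitfE -unitmxE.
apply: (mulIf Vp0); rewrite [RHS]mulrC /char_poly -!det_mulmx; congr (\det _).
(* Both determinants are now those of X V - V d, as X%:M is central. *)
rewrite /char_poly_mx mulmxBl mulmxBr -!map_mxM AV.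
by rewrite -scalar_mxC.
Qed.

(** For [n > 2] the sites [j], [j + 1] and [j - 1] are distinct modulo [n], so the
    row [j] has exactly three entries.  The morphism lets the same computation
    serve for the real matrix and for its complexification. *)
Lemma sum_tridiag_circulant {R : realType} {F : fieldType} {n : nat}
    (phi : {rmorphism R -> F}) (a b : R) (f : 'I_n -> F) (j : 'I_n) :
  (2 < n)%N ->
  \sum_k phi (tridiag_circulant n a b j k) * f k
    = phi a * f j + phi b * (f (ordS j) + f (ord_pred j)).
Proof.
move=> n2; have jn := ltn_ord j.
have Sj : (ordS j == j) = false.
  apply/negbTE/eqP => /(congr1 val) /=.
  have [jl|jl] := ltnP j.+1 n; first by rewrite modn_small //; lia.
  have -> : j.+1 = n by lia.
  by rewrite modnn; lia.
have Pj : (ord_pred j == j) = false.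
  apply/negbTE/eqP => e; have := ord_predK j; rewrite e => /eqP.
  by rewrite Sj.
have PS : (ord_pred j == ordS j) = false.
  apply/negbTE/eqP => e; have := congr1 (fun x => val (ordS x)) e.
  rewrite ord_predK /=.
  have [jl|jl] := ltnP j.+1 n.
    rewrite (modn_small jl).
    have [jl'|jl'] := ltnP j.+2 n; first by rewrite modn_small //; lia.
    have -> : j.+2 = n by lia.
    by rewrite modnn; lia.
  have -> : j.+1 = n by lia.
  by rewrite modnn modn_small; lia.
rewrite (bigD1 j) // (bigD1 (ordS j)) /= ?Sj //.
rewrite (bigD1 (ord_pred j)) /= ?Pj ?PS //.
rewrite !mxE eqxx Sj Pj !eqxx orbT /= big1 ?addr0 ?mulrDr //.
move=> k /andP[/andP[kj kS] kP].
by rewrite mxE (negbTE kj) (negbTE kS) (negbTE kP) rmorph0 mul0r.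
Qed.

Definition cis {R : realType} (t : R) : R[i]%C := (cos t +i* sin t)%C.

Lemma cisD {R : realType} (s t : R) : cis (s + t) = cis s * cis t.
Proof.
apply/eqP; rewrite eq_complex /= cosD sinD eqxx /=.
by rewrite [X in X == _]addrC.
Qed.

Lemma cis_mulrn {R : realType} (t : R) (k : nat) : cis (t *+ k) = cis t ^+ k.
Proof.
elim: k => [|k IH]; last by rewrite mulrSr cisD IH exprSr.
by rewrite mulr0n expr0 /cis cos0 sin0.
Qed.

(** As [cis t] has modulus 1, its inverse is its conjugate: this makes the
    eigenvalues of a symmetric circulant matrix real. *)
Lemma cisDV {R : realType} (t : R) : cis t + (cis t)^-1 = (2 * cos t)%:C%C.
Proof.
have u : cis t * cis (- t) = 1 by rewrite -cisD subrr /cis cos0 sin0.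
have c0 : cis t != 0.
  by apply/eqP => c0; move: u; rewrite c0 mul0r => /esym /eqP; rewrite oner_eq0.
rewrite -(mulr1 (cis t)^-1) -u mulKf //.
apply/eqP; rewrite eq_complex /= cosN sinN subrr eqxx andbT.
by rewrite mulrDl !mul1r.
Qed.

(** Because [1 - cos (2 x) = 2 sin^2 x]. *)
Lemma cos_mul2_lt1 {R : realType} (x : R) : 0 < x < pi -> cos (x *+ 2) < 1.
Proof.
move=> /sin_gt0_pi sx; rewrite cos_mulr2n cos2sin2.
have : 0 < sin x ^+ 2 by rewrite exprn_gt0.
lra.
Qed.

(** Used twice: the nonzero modes are separated from the neutral one, and the
    [n]-th root of unity [cis (2 pi / n)] is primitive. *)
Lemma cos_root_lt1 {R : realType} (n k : nat) :
  (0 < k < n)%N -> cos (2 * pi * k%:R / n%:R : R) < 1.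
Proof.
move=> /andP[k0 kn].
have n0 : 0 < n%:R :> R by rewrite ltr0n; lia.
have -> : 2 * pi * k%:R / n%:R = (pi * k%:R / n%:R) *+ 2 :> R.
  by rewrite -[RHS]mulr_natl !mulrA.
apply: cos_mul2_lt1; apply/andP; split.
  by rewrite divr_gt0 // mulr_gt0 ?pi_gt0 // ltr0n.
by rewrite ltr_pdivrMr // ltr_pM2l ?pi_gt0 // ltr_nat.
Qed.

(** Among the [n]-th roots of unity, the one of index [n./2] is closest to [-1].
    The symmetry [k <-> n - k] reduces to angles in [0, pi], where the cosine
    decreases. *)
Lemma cos_kstar_le {R : realType} (n k : nat) :
  (k <= n)%N ->
  cos (2 * pi * (kstar n)%:R / n%:R : R) <= cos (2 * pi * k%:R / n%:R).
Proof.
have [->|n0] := posnP n.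
  by rewrite leqn0 => /eqP ->.
have nR : 0 < n%:R :> R by rewrite ltr0n.
have half m : (m <= kstar n)%N ->
    cos (2 * pi * (kstar n)%:R / n%:R : R) <= cos (2 * pi * m%:R / n%:R).
  move=> mk.
  have itv p : (p <= kstar n)%N -> 2 * pi * p%:R / n%:R \in `[0, pi : R].
    move=> pk; have p2 : (p.*2 <= n)%N by move: pk; rewrite /kstar; lia.
    rewrite in_itv /= divr_ge0 ?mulr_ge0 ?pi_ge0 ?ler0n //=.
    rewrite ler_pdivrMr // mulrAC mulrC ler_pM2l ?pi_gt0 //.
    by rewrite -natrM ler_nat mul2n.
  rewrite leNgt ltr_cos ?itv // -leNgt.
  by rewrite ler_pM2r ?invr_gt0 // ler_pM2l ?mulr_gt0 ?pi_gt0 // ler_nat.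
move=> kn; have [/half//|kk] := leqP k (kstar n).
have -> : cos (2 * pi * k%:R / n%:R : R) = cos (2 * pi * (n - k)%:R / n%:R).
  rewrite natrB // mulrBr mulrBl mulfK ?gt_eqF //.
  by rewrite cosB mulr_natl cos2pi sin2pi mul1r mul0r addr0.
by apply: half; move: kk; rewrite /kstar; lia.
Qed.

Lemma tridiag_circulant_const {R : realType} {n : nat} (a b : R) :
  (2 < n)%N -> a + 2 * b = 1 ->
  tridiag_circulant n a b *m (const_mx 1 : 'cV[R]_n) = const_mx 1.
Proof.
move=> n2 ab; apply/matrixP => j k; rewrite !mxE.
under eq_bigr do rewrite [X in _ * X]mxE.
by rewrite (sum_tridiag_circulant idfun) //=; lra.
Qed.

(** On the Fourier vector [z ^+ j], with [z ^+ n = 1], the two neighbours of a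
    site contribute [z + z^-1 = 2 * cos (2 pi k / n)]. *)
Lemma char_poly_tridiag_circulant {R : realType} {n : nat} (a b : R) :
  (2 < n)%N ->
  char_poly (map_mx (real_complex R) (tridiag_circulant n a b))
    = \prod_(k < n) ('X - (a + 2 * b * cos (2 * pi * k%:R / n%:R))%:C%C%:P).
Proof.
move=> n2; pose t : R := 2 * pi / n%:R; pose w := cis t.
have nR : n%:R != 0 :> R by rewrite pnatr_eq0 -lt0n (ltn_trans _ n2).
have wk k : w ^+ k = cis (2 * pi * k%:R / n%:R).
  by rewrite -cis_mulrn -[t *+ k]mulr_natr mulrAC.
have wn : w ^+ n = 1 by rewrite wk mulfK // mulr_natl /cis cos2pi sin2pi.
have w0 : w != 0.
  apply/eqP => w0; move: wn => /eqP.
  by rewrite w0 expr0n eq_sym (gtn_eqF (leq_trans _ n2)) // oner_eq0.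
have w_neq1 k : (0 < k < n)%N -> w ^+ k != 1.
  move=> /(@cos_root_lt1 R) c1; apply/eqP; rewrite wk => -[c _].
  by rewrite c ltxx in c1.
pose V := Vandermonde n (\row_(k < n) w ^+ k).
pose d : 'rV[R[i]%C]_n :=
  \row_k (a + 2 * b * cos (2 * pi * k%:R / n%:R))%:C%C.
have Vu : V \in unitmx.
  (* A factor of the Vandermonde determinant is w^i (w^(j - i) - 1). *)
  rewrite unitmxE unitfE det_Vandermonde.
  apply/prodf_neq0 => i _; apply/prodf_neq0 => j ij.
  rewrite !mxE subr_eq0 -(subnK (ltnW ij)) exprD -subr_eq0 -[X in _ - X]mul1r.
  rewrite -mulrBl mulf_neq0 ?expf_neq0 // subr_eq0 w_neq1 //.
  by have := ltn_ord j; lia.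
rewrite (char_poly_diagonalized _ V d Vu).
  by apply: eq_bigr => k _; rewrite mxE.
apply/matrixP => j k; set z := w ^+ k.
have VE l : V l k = z ^+ l by rewrite !mxE.
rewrite mul_mx_diag !mxE -/z.
under eq_bigr => l _ do rewrite VE [X in X * _]mxE.
rewrite (sum_tridiag_circulant (real_complex R)) //.
have zn : z ^+ n = 1 by rewrite -exprM mulnC exprM wn expr1n.
have z0 : z != 0 by rewrite expf_neq0.
have zS (i : 'I_n) : z ^+ ordS i = z ^+ i * z.
  by rewrite -exprSr /= expr_mod.
have zP : z ^+ ord_pred j = z ^+ j / z.
  by rewrite -[in RHS](ord_predK j) zS mulfK.
rewrite zS zP -mulrDr /z wk cisDV -wk !(rmorphD, rmorphM) /=.
by ring.
Qed.

(** Since [a + 2 * b = 1] is forced by rotation invariance, [b] is the only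
    parameter.  The binding eigenvalue is that of the mode [kstar n], the
    smallest one. *)
Lemma linearly_stable_tridiag_circulant {R : realType} {n : nat} (b : R) :
  (2 < n)%N -> 0 < b ->
  linearly_stable (tridiag_circulant n (1 - 2 * b) b) <->
  b * (1 - cos (2 * pi * (kstar n)%:R / n%:R)) < 1.
Proof.
move=> n2 b0.
pose mu k : R := (1 - 2 * b) + 2 * b * cos (2 * pi * k%:R / n%:R).
have muE k : mu k = 1 - 2 * (b * (1 - cos (2 * pi * k%:R / n%:R))).
  by rewrite /mu; lra.
have cpE := @char_poly_tridiag_circulant R n (1 - 2 * b) b n2.
have mu_lt1 k : (0 < k < n)%N -> mu k < 1.
  move=> /(@cos_root_lt1 R) ck; rewrite muE.
  have : 0 < b * (1 - cos (2 * pi * k%:R / n%:R)).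
    by rewrite mulr_gt0 // subr_gt0.
  by lra.
have normC (x : R) : `|x%:C%C| = `|x|%:C%C.
  by rewrite normc_def /= expr0n addr0 sqrtr_sqr.
have ks : (0 < kstar n < n)%N by rewrite /kstar; lia.
split=> [[_ [lam [cp lam0 lam_lt1]]]|crit].
  have : root (char_poly (map_mx (real_complex R)
      (tridiag_circulant n (1 - 2 * b) b))) (mu (kstar n))%:C%C.
    have /andP[_ ksn] := ks.
    rewrite cpE rootE horner_prod; apply/prodf_eq0.
    by exists (Ordinal ksn) => //; rewrite hornerXsubC subrr.
  rewrite cp => /rootP; rewrite horner_prod => /eqP /prodf_eq0[k _].
  rewrite hornerXsubC subr_eq0 => /eqP muk.
  (* The eigenvalue mu (kstar n) is listed at index k; if k were 0 it would
     equal lam 0 = 1. *)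
  have [k0|k0] := posnP k.
    have := mu_lt1 _ ks; move: muk; rewrite k0 lam0 => -[->].
    by rewrite ltxx.
  have := lam_lt1 k; rewrite k0 ltn_ord => /(_ isT).
  by rewrite -muk normC -[1]/(1%:C%C) ltcR ltr_norml muE; lra.
split; first by apply: tridiag_circulant_const => //; lra.
exists (fun k => (mu k)%:C%C); split=> // [|k kn].
  by rewrite muE mulr0 mul0r cos0 subrr !mulr0 subr0.
rewrite normC -[1]/(1%:C%C) ltcR ltr_norml mu_lt1 // andbT muE.
have : b * (1 - cos (2 * pi * k%:R / n%:R)) <=
       b * (1 - cos (2 * pi * (kstar n)%:R / n%:R)).
  rewrite ler_pM2l // lerD2l lerN2 cos_kstar_le //.
  by have /andP[_ /ltnW] := kn.
by lra.
Qed.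

Theorem corollary4p6 (R : realType) (n : nat) (kappa : R)
    (hn : (2 < n)%N) (hkappa : 0 <= kappa) (hbeta : 0 < beta n kappa) :
  (linearly_stable (Jstar n kappa) <-> stability_criterion n kappa) /\
  (let T : 'rV[R]_n -> 'rV[R]_n := lloyd_map (von_mises kappa) in
   T (Qstar n) = Qstar n ->
   partials T (Qstar n) = Jstar n kappa ->
   (linearly_stable (partials T (Qstar n)) <-> stability_criterion n kappa)).
Proof.
have stableE : linearly_stable (Jstar n kappa) <-> stability_criterion n kappa.
  have betaE : von_mises kappa (pi / n%:R) / cell_mass n kappa * (pi / n%:R)
      = 2 * beta n kappa.
    rewrite /beta !invfM; set h := von_mises _ _; set m := (cell_mass _ _)^-1.
    by set s := (_%:R)^-1; field.
  rewrite /Jstar; have -> : alpha n kappa = 1 - 2 * beta n kappa.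
    by rewrite -betaE /alpha invfM; ring.
  rewrite /stability_criterion betaE.
  have c1 : 0 < 1 - cos (2 * pi * (kstar n)%:R / n%:R) :> R.
    by rewrite subr_gt0 cos_root_lt1 // /kstar; lia.
  rewrite ltr_pdivlMr //.
  apply: iff_trans (linearly_stable_tridiag_circulant _ _ _) _ => //.
  by split; lra.
by split=> // T _ ->.
Qed.
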